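(* Let $f\colon H_1\to H_2$ be a continuous map between Heyting lattices, with left adjoint $f^*\colon H_2\to H_1$. The following are equivalent: (i) $f$ is a closed map. (ii) $f$ is a basic closed map (as a basic continuous map $(H_1,\mathfrak{c}H_1,\mathcal{B}d(H_1))\to(H_2,\mathfrak{c}H_2,\mathcal{B}d(H_2))$). (iii) The $\mathfrak{c}$-basic preimage $f_{\leftarrow}^{\mathfrak{c}}\colon\mathfrak{c}H_2\to\mathfrak{c}H_1$ has a left adjoint $h\colon\mathfrak{c}H_1\to\mathfrak{c}H_2$ such that $h[\mathfrak{c}a\cap f_{\leftarrow}[\mathfrak{c}b]]=h[\mathfrak{c}a]\cap\mathfrak{c}b$ for every $a\in H_1$ and $b\in H_2$. (iv) For every $a\in H_1$ and $b\in H_2$, $f(a\vee f^*(b))=f(a)\vee b$. (v) For every $a\in H_1$, $f[\mathfrak{c}a]=\mathfrak{c}(f(a))$.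
   Context: A Heyting semilattice is a meet-semilattice $H$ with top $1$ and a binary operation $\to$ satisfying $a\wedge b\le c\Leftrightarrow b\le a\to c$; a Heyting lattice (Heyting algebra) is a lattice (with bottom $0$ and top $1$) with such an operation. A map between Heyting semilattices is continuous if it has a left adjoint that preserves finite meets (including the top element). For $a\in H$: $\mathfrak{o}a=\{a\to x\mid x\in H\}$ and $\mathfrak{c}a=\{x\in H\mid x\ge a\}$; $\mathfrak{c}H=\{\mathfrak{c}a\mid a\in H\}$, ordered by inclusion. A continuous map $f\colon H_1\to H_2$ is closed if $f[\mathfrak{c}a]\in\mathfrak{c}H_2$ for every $a\in H_1$. An ideal of $H$ is a subset $T\subseteq H$ containing $1$, closed under binary meets, and such that $x\to t\in T$ for all $x\in H$, $t\in T$; the set $\mathcal{I}dl(H)$ of ideals, ordered by inclusion, is a complete distributive lattice with intersections as meets. All $\mathfrak{c}a,\mathfrak{o}a$ are ideals and are complements of each other. $\mathcal{B}d(H)$ (basic domains of $H$) is the set of all subsets of the form $\bigcap_{i\in J}(\mathfrak{c}a_i^1\vee\mathfrak{o}b_i^1\vee\dots\vee\mathfrak{c}a_i^{n_i}\vee\mathfrak{o}b_i^{n_i})$ with joins taken in $\mathcal{I}dl(H)$. The triple $(H,\mathfrak{c}H,\mathcal{B}d(H))$ is a b0-space in the following sense, with complements $\neg\mathfrak{c}a=\mathfrak{o}a$ and bottom $\{1\}$. A basic zero-dimensional space (b0-space) is a triple $\mathcal{S}=(X,\mathcal{C},\mathcal{B}d)$ where $X$ is a set, $\mathcal{B}d$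 is a closure system on $X$ (contains $X$, closed under arbitrary intersections) that is distributive as a lattice (joins $\vee$ in $\mathcal{B}d$ being the least members containing the union), and $\mathcal{C}\subseteq\mathcal{B}d$ is such that every $C\in\mathcal{C}$ has a complement $\neg C$ in $\mathcal{B}d$, and every $M\in\mathcal{B}d$ is an intersection of finite joins of elements $C\vee\neg D$ with $C,D\in\mathcal{C}$. Its closed domains are the elements of $\mathcal{C}$; its bottom is denoted $\mathsf{O}$. A basic continuous map $f\colon(X,\mathcal{C}_X,\mathcal{B}d_X)\to(Y,\mathcal{C}_Y,\mathcal{B}d_Y)$ is a map $f\colon X\to Y$ such that: $f^{-1}[\mathsf{O}]=\mathsf{O}$; there is a (necessarily unique) map $f_{\leftarrow}^{\mathfrak{c}}\colon\mathcal{C}_Y\to\mathcal{C}_X$, called the $\mathfrak{c}$-basic preimage, with $f[B]\subseteq C$ iff $B\subseteq f_{\leftarrow}^{\mathfrak{c}}[C]$ for all $B\in\mathcal{C}_X$, $C\in\mathcal{C}_Y$; $\neg f_{\leftarrow}^{\mathfrak{c}}[C]\subseteq f^{-1}[\neg C]$ for all $C\in\mathcal{C}_Y$; and $\bigvee_{i=1}^n(f_{\leftarrow}^{\mathfrak{c}}[C_i]\vee\neg f_{\leftarrow}^{\mathfrak{c}}[D_i])\subseteq f^{-1}[\bigvee_{i=1}^n(C_i\vee\neg D_i)]$ for all $C_i,D_i\in\mathcal{C}_Y$. The basic image is $f_{\rightarrow}[M]=\bigcap\{S\in\mathcal{B}d_Y\mid f[M]\subseteq S\}$ for $M\in\mathcal{B}d_X$;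 it has a right adjoint $f_{\leftarrow}\colon\mathcal{B}d_Y\to\mathcal{B}d_X$, the basic preimage, which extends $f_{\leftarrow}^{\mathfrak{c}}$. $f$ is basic closed if $f_{\rightarrow}$ sends closed domains to closed domains. Every continuous map $f\colon H_1\to H_2$ of Heyting semilattices is basic continuous between the associated b0-spaces, with $f_{\leftarrow}^{\mathfrak{c}}[\mathfrak{c}b]=f_{\leftarrow}[\mathfrak{c}b]=\mathfrak{c}(f^*(b))$. *)

(* Defs.v *)
From HB Require Import structures.
From mathcomp Require Import all_boot all_order.
From mathcomp Require Import boolp classical_sets.

Set Implicit Arguments.
Unset Strict Implicit.
Unset Printing Implicit Defensive.

Import Order.TTheory.
Local Open Scope classical_set_scope.
Local Open Scope order_scope.

(* In order_scope, `&` and `|` are the lattice operations; inside %classic they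
   are intersection and union of sets. *)

HB.mixin Record isHeyting (d : Order.disp_t) T
    of Order.TMeetSemilattice d T := {
  imp : T -> T -> T;
  impP : forall a b c : T, (a `&` b <= c) = (b <= imp a c)
}.

#[short(type="heytingSemilatticeType")]
HB.structure Definition HeytingSemilattice (d : Order.disp_t) :=
  { T of isHeyting d T & Order.TMeetSemilattice d T }.

#[short(type="heytingLatticeType")]
HB.structure Definition HeytingLattice (d : Order.disp_t) :=
  { T of isHeyting d T & Order.TBLattice d T }.

Notation "a ~> b" := (imp a b) (at level 55, right associativity) : order_scope.

Section ClosureSystems.
Variable X : Type.
Implicit Types (Bd Cd : set (set X)) (A B C N : set X).

Definition closure_system Bd : Prop :=
  Bd setT /\
  (forall F : set (set X), F `<=` Bd -> Bd (\bigcap_(M in F) M)).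

Definition csbot Bd : set X := smallest Bd set0.

Definition csjoin Bd A B : set X := smallest Bd (A `|` B)%classic.

Definition csjoins Bd n (M : 'I_n -> set X) : set X :=
  smallest Bd (\bigcup_(i in [set: 'I_n]) M i).

Definition cs_distributive Bd : Prop :=
  forall A B C, Bd A -> Bd B -> Bd C ->
    (A `&` csjoin Bd B C)%classic =
    csjoin Bd (A `&` B)%classic (A `&` C)%classic.

Definition is_complement Bd C N : Prop :=
  [/\ Bd N, (C `&` N)%classic = csbot Bd & csjoin Bd C N = setT].

(* Complements are unique when Bd is distributive; the value is meaningless
   when C has no complement. *)
Definition csneg Bd C : set X := xget set0 (is_complement Bd C).

Definition basic_joins Bd Cd : set (set X) :=
  [set S | exists n (C D : 'I_n -> set X),
    (forall i, Cd (C i) /\ Cd (D i)) /\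
    S = csjoins Bd (fun i => csjoin Bd (C i) (csneg Bd (D i)))].

Lemma csneg_unique Bd C N N' : closure_system Bd -> cs_distributive Bd -> Bd C ->
  is_complement Bd C N -> is_complement Bd C N' -> N = N'.
Proof.
move=> [BT BI] dB bC.
suff W P Q : is_complement Bd C P -> is_complement Bd C Q -> P `<=` Q.
  by move=> c c'; apply/seteqP; split; exact: W.
move=> [bP CP _] [bQ _ CQ].
rewrite -[P]setIT -CQ dB // => x; apply: smallest_sub x => //.
move=> x [|[]//]; rewrite setIC CP => h.
exact: (smallest_sub bQ (@sub0set _ _) h).
Qed.

End ClosureSystems.

Record b0space : Type := B0Space {
  b0_car :> Type;
  cdom : set (set b0_car);
  bdom : set (set b0_car);
  bdom_closure_system : closure_system bdom;
  bdom_distributive : cs_distributive bdom;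
  cdom_bdom : cdom `<=` bdom;
  cdom_complemented : forall C, cdom C -> exists N, is_complement bdom C N;
  bdom_generated : forall M, bdom M ->
    exists2 F : set (set b0_car),
      F `<=` basic_joins bdom cdom & M = \bigcap_(S in F) S
}.

Section BasicMaps.
Variables X Y : b0space.
Implicit Types (f : X -> Y).

Definition adjoint_on (P : set (set X)) (Q : set (set Y))
    (l : set X -> set Y) (r : set Y -> set X) : Prop :=
  (forall S, Q S -> P (r S)) /\
  (forall M S, P M -> Q S -> (l M `<=` S <-> M `<=` r S)).

Definition is_cpreimage f (g : set Y -> set X) : Prop :=
  adjoint_on (@cdom X) (@cdom Y) (fun B => f @` B) g.

Definition basic_continuous f : Prop :=
  f @^-1` csbot (@bdom Y) = csbot (@bdom X) /\
  exists g : set Y -> set X,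
    [/\ is_cpreimage f g,
        forall C, cdom C -> csneg (@bdom X) (g C) `<=` f @^-1` csneg (@bdom Y) C
      & forall n (C D : 'I_n -> set Y),
          (forall i, cdom (C i) /\ cdom (D i)) ->
          csjoins (@bdom X)
            (fun i => csjoin (@bdom X) (g (C i)) (csneg (@bdom X) (g (D i))))
          `<=` f @^-1` csjoins (@bdom Y)
            (fun i => csjoin (@bdom Y) (C i) (csneg (@bdom Y) (D i)))].

(* The values of cpreimage f are determined on closed domains of Y, and those of
   bpreimage f on members of bdom; elsewhere they are arbitrary. *)
Definition cpreimage f : set Y -> set X :=
  xget (fun=> set0) [set g | is_cpreimage f g].

Definition bimage f (M : set X) : set Y := smallest (@bdom Y) (f @` M).

Definition bpreimage f : set Y -> set X :=
  xget (fun=> set0) [set g | adjoint_on (@bdom X) (@bdom Y) (bimage f) g].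

Definition basic_closed f : Prop :=
  basic_continuous f /\ (forall C, cdom C -> cdom (bimage f C)).

Definition cdom_left_adjoint (h : set X -> set Y) (g : set Y -> set X) : Prop :=
  (forall C, cdom C -> cdom (h C)) /\ adjoint_on (@cdom X) (@cdom Y) h g.

End BasicMaps.

Section HeytingSubsets.
Variables (d : Order.disp_t) (H : heytingSemilatticeType d).
Implicit Types (a b c x y : H) (T : set H).

Definition cset a : set H := [set x | a <= x].
Definition oset a : set H := [set a ~> x | x in [set: H]].
Definition csets : set (set H) := [set cset a | a in [set: H]].

Definition ideal : set (set H) :=
  [set T : set H | [/\ T \top,
                       forall x y, T x -> T y -> T (x `&` y)
                     & forall x t, T t -> T (x ~> t)]].

(* For n = 0 this yields the bottom ideal, which is also the intersection of the
   sets given by a = \top and an arbitrary b, hence no new member of bd. *)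
Definition bd_gen : set (set H) :=
  [set S | exists n (a b : 'I_n -> H),
    S = csjoins ideal (fun i => csjoin ideal (cset (a i)) (oset (b i)))].

Definition bd : set (set H) :=
  [set S | exists2 F : set (set H), F `<=` bd_gen & S = \bigcap_(M in F) M].

Lemma imp_mp x y : Order.meet x (x ~> y) <= y. Proof. by rewrite impP. Qed.

Lemma imp_le x y : y <= x ~> y. Proof. by rewrite -impP leIr. Qed.

Lemma imp_eq1 x y : (x ~> y == \top) = (x <= y).
Proof. by rewrite -le1x -impP meetx1. Qed.

Lemma imp_mono x y z : y <= z -> x ~> y <= x ~> z.
Proof. by move=> yz; rewrite -impP; exact: le_trans (imp_mp _ _) yz. Qed.

Lemma imp_anti x y z : y <= x -> x ~> z <= y ~> z.
Proof.
move=> yx; rewrite -impP; apply: le_trans (imp_mp x z).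
by apply: leI2.
Qed.

Lemma imp_meet x y z : x ~> Order.meet y z = Order.meet (x ~> y) (x ~> z).
Proof.
apply/le_anti/andP; split.
  by rewrite lexI !imp_mono ?leIl ?leIr.
rewrite -impP lexI; apply/andP; split.
  by apply: le_trans (imp_mp x y); apply: leI2 => //; exact: leIl.
by apply: le_trans (imp_mp x z); apply: leI2 => //; exact: leIr.
Qed.

Lemma imp_curry x y z : x ~> (y ~> z) = Order.meet x y ~> z.
Proof.
have E t : (t <= x ~> (y ~> z)) = (t <= Order.meet x y ~> z).
  by rewrite -!impP meetA [Order.meet y x]meetC.
by apply/le_anti/andP; split; [rewrite -E | rewrite E].
Qed.

Lemma impxx x : x ~> x = \top. Proof. by apply/eqP; rewrite imp_eq1. Qed.

Lemma impx1 x : x ~> \top = \top. Proof. by apply/eqP; rewrite imp_eq1 lex1. Qed.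

Lemma imp1x x : \top ~> x = x.
Proof.
apply/le_anti/andP; split; last exact: imp_le.
by apply: le_trans (imp_mp \top x); rewrite meet1x.
Qed.

Lemma meet_imp x y : Order.meet x (x ~> y) = Order.meet x y.
Proof.
apply/le_anti/andP; split; first by rewrite lexI leIl imp_mp.
by apply: leI2 => //; exact: imp_le.
Qed.

Lemma imp_idem x y : x ~> (x ~> y) = x ~> y.
Proof. by rewrite imp_curry meetxx. Qed.

Lemma imp_split a x : x = Order.meet ((a ~> x) ~> x) (a ~> x).
Proof. by rewrite meetC meet_imp; apply/esym/meet_idPr/imp_le. Qed.

Lemma ideal_top T : ideal T -> T \top. Proof. by case. Qed.
Lemma ideal_meet T x y : ideal T -> T x -> T y -> T (x `&` y).
Proof. by case=> _ + _; apply. Qed.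
Lemma ideal_imp T x y : ideal T -> T y -> T (x ~> y).
Proof. by case=> _ _; apply. Qed.

Lemma ideal_closure : closure_system ideal.
Proof.
split=> // F FI; split=> [M /FI[]//|x y Fx Fy M FM|x t Ft M FM].
  by apply: ideal_meet; [exact: FI | exact: Fx | exact: Fy].
by apply: ideal_imp; [exact: FI | exact: Ft].
Qed.

Lemma ideal_smallest (U : set H) : ideal (smallest ideal U).
Proof. by apply: ideal_closure.2 => M []. Qed.

Lemma ideal_bottom : ideal [set (\top : H)].
Proof. by split=> //= [x y -> ->|x t ->]; rewrite ?meetxx ?impx1. Qed.

Lemma csbot_ideal : csbot ideal = [set (\top : H)].
Proof.
apply/seteqP; split; first exact: (smallest_sub ideal_bottom).
by move=> _ ->; exact: ideal_top (ideal_smallest _).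
Qed.

Lemma ideal_cset a : ideal (cset a).
Proof.
split; rewrite /cset /=.
- by rewrite lex1.
- by move=> x y ax ay; rewrite lexI ax.
- by move=> x t ha; exact: le_trans ha (imp_le _ _).
Qed.

Lemma ideal_oset a : ideal (oset a).
Proof.
split; rewrite /oset /=.
- by exists \top => //; rewrite impx1.
- by move=> _ _ [x _ <-] [y _ <-]; exists (Order.meet x y) => //; rewrite imp_meet.
- by move=> x _ [t _ <-]; exists (x ~> t) => //; rewrite !imp_curry meetC.
Qed.

Lemma csjoin_ideal A B : ideal A -> ideal B ->
  csjoin ideal A B = [set x | exists u v, [/\ A u, B v & x = Order.meet u v]].
Proof.
move=> iA iB; apply/seteqP; split.
  apply: smallest_sub.
    split=> /=.
    - exists \top, \top; rewrite meetxx.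
      by split=> //; [exact: ideal_top iA|exact: ideal_top iB].
    - move=> _ _ [u [v [Au Bv ->]]] [u' [v' [Au' Bv' ->]]].
      exists (Order.meet u u'), (Order.meet v v'); rewrite meetACA.
      by split=> //; [exact: (ideal_meet iA)|exact: (ideal_meet iB)].
    - move=> x _ [u [v [Au Bv ->]]]; exists (x ~> u), (x ~> v).
      rewrite imp_meet.
      by split=> //; [exact: (ideal_imp x iA)|exact: (ideal_imp x iB)].
  move=> x [Ax|Bx].
    by exists x, \top; rewrite meetx1; split=> //; exact: ideal_top iB.
  by exists \top, x; rewrite meet1x; split=> //; exact: ideal_top iA.
move=> _ [u [v [Au Bv ->]]].
apply: (ideal_meet (ideal_smallest _)); apply: sub_gen_smallest.
  by left.
by right.
Qed.

Lemma ideal_csjoin A B : ideal (csjoin ideal A B).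
Proof. exact: ideal_smallest. Qed.

Lemma ideal_distr A B C x : ideal A -> ideal B -> ideal C ->
  A x -> csjoin ideal B C x ->
  exists u v, [/\ (A `&` B)%classic u, (A `&` C)%classic v & x = Order.meet u v].
Proof.
move=> iA iB iC Ax; rewrite csjoin_ideal //= => -[b [c [Bb Cc xE]]].
have uE : c ~> x = c ~> b by rewrite xE imp_meet impxx meetx1.
exists (c ~> x), ((c ~> x) ~> x); split.
- by split; [exact: ideal_imp | rewrite uE; exact: ideal_imp].
- split; first exact: ideal_imp.
  have -> : (c ~> x) ~> x = (c ~> x) ~> c; last exact: ideal_imp.
  apply/le_anti/andP; split; first by apply: imp_mono; rewrite xE leIr.
  by rewrite -impP meet_imp meetC meet_imp leIr.
- by rewrite meet_imp; apply/esym/meet_idPr/imp_le.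
Qed.

(* Ideals k and k' are complementary, and the part of x in k' lies in every
   ideal containing x. *)
Definition ideal_split (k k' : set H) : Prop :=
  [/\ ideal k, ideal k', (k `&` k')%classic `<=` [set \top] &
      forall x, exists u v,
        [/\ k u, k' v, x = Order.meet u v & exists p, v = p ~> x]].

Lemma cset_oset a x : cset a x -> oset a x -> x = \top.
Proof.
rewrite /cset /oset /= => ax [y _ yx].
by rewrite -yx -imp_idem yx; apply/eqP; rewrite imp_eq1.
Qed.

Lemma split_co a : ideal_split (cset a) (oset a).
Proof.
split; [exact: ideal_cset|exact: ideal_oset| by move=> x [] /=; apply: cset_oset|].
move=> x; exists ((a ~> x) ~> x), (a ~> x); split.
- by rewrite /cset /= -impP meetC imp_mp.
- by exists x.
- exact: imp_split.
- by exists a.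
Qed.

Lemma split_oc a : ideal_split (oset a) (cset a).
Proof.
split; [exact: ideal_oset|exact: ideal_cset| |].
  by move=> x [] /= ox cx; exact: (@cset_oset a).
move=> x; exists (a ~> x), ((a ~> x) ~> x); split.
- by exists x.
- by rewrite /cset /= -impP meetC imp_mp.
- by rewrite meetC; exact: imp_split.
- by exists (a ~> x).
Qed.

Lemma split_join k k' l l' : ideal_split k k' -> ideal_split l l' ->
  ideal_split (csjoin ideal k l) (k' `&` l')%classic.
Proof.
move=> [ik ik' kk' sk] [il il' ll' sl]; split.
- exact: ideal_csjoin.
- split=> [|x y [? ?] [? ?]|x t [? ?]].
  + by split; exact: ideal_top.
  + by split; exact: ideal_meet.
  + by split; exact: ideal_imp.
- move=> x [jx [k'x l'x]].
  have [u [v [[_ ku] [_ lv] xE]]] := ideal_distr ik' ik il k'x jx.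
  have wx : v ~> x = \top.
    apply: kk'; split; last exact: ideal_imp.
    by rewrite xE imp_meet impxx meetx1; exact: ideal_imp.
  have xv : x = v.
    by apply/le_anti; rewrite {1}xE leIr -imp_eq1 wx eqxx.
  by apply: ll'; split=> //=; rewrite xv.
- move=> x; have [u [v [ku k'v xE [p vE]]]] := sk x.
  have [w [z [lw l'z vE' [q zE]]]] := sl v.
  exists (Order.meet u w), z; split=> //.
  + by rewrite csjoin_ideal //; exists u, w.
  + by split=> //; rewrite zE; exact: ideal_imp.
  + by rewrite xE {1}vE' meetA.
  + by exists (Order.meet q p); rewrite zE vE imp_curry.
Qed.

Lemma csjoins0 (M : 'I_0 -> set H) : csjoins ideal M = [set \top].
Proof.
rewrite -csbot_ideal /csjoins; congr smallest.
by apply/seteqP; split=> // x [[]].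
Qed.

Lemma csjoinsS n (M : 'I_n.+1 -> set H) : csjoins ideal M =
  csjoin ideal (M ord0) (csjoins ideal (fun i => M (lift ord0 i))).
Proof.
apply/seteqP; split; apply: smallest_sub; try exact: ideal_smallest.
  move=> x [i _ Mx]; apply: sub_gen_smallest.
  case: (unliftP ord0 i) Mx => [j ->|->] Mx; last by left.
  by right; apply: sub_gen_smallest; exists j.
move=> x [Mx|]; first by apply: sub_gen_smallest; exists ord0.
apply: smallest_sub x; first exact: ideal_smallest.
by move=> x [i _ Mx]; apply: sub_gen_smallest; exists (lift ord0 i).
Qed.

Lemma split_bd_gen S : bd_gen S -> exists S', ideal_split S S'.
Proof.
move=> [n [a [b ->]]]; elim: n a b => [|n IHn] a b.
  exists setT; rewrite csjoins0; split=> //; first exact: ideal_bottom.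
  move=> x; exists \top, x; rewrite meet1x; split=> //.
    by exists \top; rewrite imp1x.
have [S' SS'] := IHn (fun i => a (lift ord0 i)) (fun i => b (lift ord0 i)).
exists ((oset (a ord0) `&` cset (b ord0)) `&` S')%classic.
rewrite csjoinsS; apply: split_join => //.
exact: split_join (split_co _) (split_oc _).
Qed.

Lemma ideal_bd_gen S : bd_gen S -> ideal S.
Proof. by move=> [n [a [b ->]]]; exact: ideal_smallest. Qed.

Lemma bd_gen_bd : bd_gen `<=` bd.
Proof.
move=> S gS; exists [set S]; first by move=> _ ->.
by rewrite bigcap_set1.
Qed.

Lemma ideal_bd S : bd S -> ideal S.
Proof.
move=> [F FG ->]; apply: ideal_closure.2 => M /FG; exact: ideal_bd_gen.
Qed.

Lemma bd_genU S S' : bd_gen S -> bd_gen S' -> bd_gen (csjoin ideal S S').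
Proof.
move=> [n [a [b ->]]] [m [a' [b' ->]]].
pose glue (g : 'I_n -> H) (g' : 'I_m -> H) (i : 'I_(n + m)) :=
  match split i with inl j => g j | inr j => g' j end.
exists (n + m)%N, (glue a a'), (glue b b').
apply/seteqP; split; apply: smallest_sub; try exact: ideal_smallest.
  move=> x [] Jx.
    apply: smallest_sub Jx; first exact: ideal_smallest.
    move=> {}x [i _ Mx]; apply: sub_gen_smallest; exists (lshift m i) => //.
    by rewrite /glue (unsplitK (inl i)).
  apply: smallest_sub Jx; first exact: ideal_smallest.
  move=> {}x [i _ Mx]; apply: sub_gen_smallest; exists (rshift n i) => //.
  by rewrite /glue (unsplitK (inr i)).
move=> x [i _]; rewrite /glue; case: (split i) => j Mx; apply: sub_gen_smallest.
  by left; apply: sub_gen_smallest; exists j.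
by right; apply: sub_gen_smallest; exists j.
Qed.

Lemma bd_closure : closure_system bd.
Proof.
split; first by exists set0 => //; rewrite bigcap_set0.
move=> F FB; exists [set G | bd_gen G /\ \bigcap_(M in F) M `<=` G].
  by move=> G [].
apply/seteqP; split=> [x Fx G [_]|x Gx M FM]; first exact.
have [E EG ME] := FB _ FM; rewrite ME => G EG'.
apply: Gx; split; first exact: EG.
by move=> y /(_ _ FM); rewrite ME; apply.
Qed.

Lemma bd_smallest (U : set H) : bd (smallest bd U).
Proof. by apply: bd_closure.2 => M []. Qed.

Lemma bd_sub M : bd M -> forall x, (forall G, bd_gen G -> M `<=` G -> G x) -> M x.
Proof.
move=> [F FG ->] x h G FGG; apply: h; first exact: FG.
by move=> y; apply.
Qed.

Lemma bd_distributive : cs_distributive bd.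
Proof.
move=> M A B bM bA bB; apply/seteqP; split; last first.
  apply: smallest_sub.
    have bI : bd (\bigcap_(S in [set M; csjoin bd A B]) S).
      by apply: bd_closure.2 => _ [] -> //; exact: bd_smallest.
    by move: bI; rewrite bigcap_setU !bigcap_set1.
  move=> x [] [Mx Nx]; split=> //; apply: sub_gen_smallest; [by left|by right].
move=> x [Mx Jx]; apply: (bd_sub (bd_smallest _)) => k gk kS.
have kA y : M y -> A y -> k y.
  by move=> My Ay; apply: kS; apply: sub_gen_smallest; left.
have kB y : M y -> B y -> k y.
  by move=> My By; apply: kS; apply: sub_gen_smallest; right.
have [k' [ik ik' kk' sk]] := split_bd_gen gk.
have [u [v [ku k'v xE [p vE]]]] := sk x.
suff v1 : v = \top by rewrite xE v1 meetx1.
have Mv : M v by rewrite vE; exact: (ideal_imp p (ideal_bd bM)).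
have Jv : csjoin bd A B v.
  by rewrite vE; exact: (ideal_imp p (ideal_bd (bd_smallest _))).
apply: (kk' _); split=> //; apply: kA => //.
apply: bd_sub => // f gf Af.
have [f' [if_ if' ff' sf]] := split_bd_gen gf.
have [v1 [v2 [fv1 f'v2 vE' [q v2E]]]] := sf v.
suff v21 : v2 = \top by rewrite vE' v21 meetx1.
have Mv2 : M v2 by rewrite v2E; exact: (ideal_imp q (ideal_bd bM)).
have k'v2 : k' v2 by rewrite v2E; exact: (ideal_imp q ik').
apply: (kk' _); split=> //; apply: kB => //.
apply: bd_sub => // g gg Bg.
have ig := ideal_bd_gen gg.
have Jv2 : csjoin ideal f g v2.
  rewrite v2E; apply: (ideal_imp q (ideal_csjoin _ _)).
  apply: smallest_sub Jv; first exact: bd_gen_bd (bd_genU gf gg).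
  by move=> y [/Af|/Bg] ?; apply: sub_gen_smallest; [left|right].
have [w [z [[f'w fw] [_ gz] ->]]] := ideal_distr if' if_ ig f'v2 Jv2.
by rewrite (ff' w) ?meet1x.
Qed.

Lemma smallest_bd_ideal (U : set H) :
  bd (smallest ideal U) -> smallest bd U = smallest ideal U.
Proof.
move=> bU; apply/seteqP; split; first exact: smallest_sub.
by apply: smallest_sub => //; apply: ideal_bd; exact: bd_smallest.
Qed.

Lemma csbot_bd : csbot bd = [set (\top : H)].
Proof.
rewrite -csbot_ideal; apply: smallest_bd_ideal; apply: bd_gen_bd.
exists 0%N, (fun=> \top), (fun=> \top); rewrite csjoins0; exact: csbot_ideal.
Qed.

Lemma bd_gen_co a b : bd_gen (csjoin ideal (cset a) (oset b)).
Proof.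
exists 1%N, (fun=> a), (fun=> b); rewrite csjoinsS csjoins0.
apply/seteqP; split.
  by move=> x Jx; apply: sub_gen_smallest; left.
apply: smallest_sub; first exact: ideal_csjoin.
by move=> x [//|->]; exact: ideal_top (ideal_csjoin _ _).
Qed.

Lemma bd_oset a : bd (oset a).
Proof.
apply: bd_gen_bd; have := bd_gen_co \top a; congr bd_gen.
apply/seteqP; split=> [|x ox]; last by apply: sub_gen_smallest; right.
apply: smallest_sub; first exact: ideal_oset.
move=> x [|//]; rewrite /cset /= le1x => /eqP ->.
exact: ideal_top (ideal_oset _).
Qed.

Lemma bd_cset a : bd (cset a).
Proof.
exists [set csjoin ideal (cset a) (oset b) | b in [set: H]].
  by move=> _ [b _ <-]; exact: bd_gen_co.
apply/seteqP; split=> [x ax _ [b _ <-]|x h].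
  by apply: sub_gen_smallest; left.
have := h _ (imageP (fun b => csjoin ideal (cset a) (oset b)) (I : setT x)).
rewrite csjoin_ideal; [|exact: ideal_cset|exact: ideal_oset].
move=> [u [v [au ov xE]]].
suff v1 : v = \top by rewrite xE v1 meetx1.
by apply: (@cset_oset x) ov; rewrite /cset /= {1}xE leIr.
Qed.

Lemma cset_complement a : is_complement bd (cset a) (oset a).
Proof.
split; first exact: bd_oset.
  rewrite csbot_bd; apply/seteqP; split=> [x [ax ox]|_ ->].
    exact: (@cset_oset a).
  by split; [exact: ideal_top (ideal_cset _)|exact: ideal_top (ideal_oset _)].
apply/seteqP; split=> // x _.
have [_ _ _ /(_ x) [u [v [au ov -> _]]]] := split_co a.
apply: (ideal_meet (ideal_bd (bd_smallest _))).
  by apply: sub_gen_smallest; left.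
by apply: sub_gen_smallest; right.
Qed.

Lemma csneg_cset a : csneg bd (cset a) = oset a.
Proof.
apply: (csneg_unique bd_closure bd_distributive (bd_cset a)).
  apply: (@xgetPex _ set0 (is_complement bd (cset a))).
  by exists (oset a); exact: cset_complement.
exact: cset_complement.
Qed.

Lemma csjoin_bd_co a b :
  csjoin bd (cset a) (oset b) = csjoin ideal (cset a) (oset b).
Proof. by apply: smallest_bd_ideal; exact: bd_gen_bd (bd_gen_co a b). Qed.

Lemma bd_gen_basic_joins : bd_gen `<=` basic_joins bd csets.
Proof.
move=> S [n [a [b SE]]].
exists n, (fun i => cset (a i)), (fun i => cset (b i)); split.
  by move=> i; split; [exists (a i)|exists (b i)].
rewrite (_ : (fun i => _) = fun i => csjoin ideal (cset (a i)) (oset (b i))).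
  rewrite /csjoins smallest_bd_ideal //.
  by apply: bd_gen_bd; exists n, a, b.
by apply/funext => i; rewrite csneg_cset csjoin_bd_co.
Qed.

Lemma csets_bd : csets `<=` bd.
Proof. by move=> _ [a _ <-]; exact: bd_cset. Qed.

Lemma csets_complemented C : csets C -> exists N, is_complement bd C N.
Proof. by move=> [a _ <-]; exists (oset a); exact: cset_complement. Qed.

Lemma bd_generated M : bd M ->
  exists2 F : set (set H), F `<=` basic_joins bd csets & M = \bigcap_(S in F) S.
Proof.
move=> [F FG ME]; exists F => //.
by move=> S /FG; exact: bd_gen_basic_joins.
Qed.

Definition heyting_b0space : b0space :=
  B0Space bd_closure bd_distributive csets_bd csets_complemented bd_generated.

End HeytingSubsets.

Section HeytingMaps.
Variables (d1 d2 : Order.disp_t).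
Variables (H1 : heytingSemilatticeType d1) (H2 : heytingSemilatticeType d2).
Implicit Types (f : H1 -> H2) (fs : H2 -> H1).

Definition left_adjoint fs f : Prop :=
  forall (b : H2) (a : H1), (fs b <= a) = (b <= f a).

Definition preserves_finite_meets fs : Prop :=
  fs \top = \top /\ (forall x y, fs (x `&` y) = fs x `&` fs y).

Definition heyting_continuous f : Prop :=
  exists2 fs, left_adjoint fs f & preserves_finite_meets fs.

Definition closed_map f : Prop := forall a, csets (f @` cset a).

End HeytingMaps.

(* Main.v *)
Require Import Defs.
From HB Require Import structures.
From mathcomp Require Import all_boot all_order.
From mathcomp Require Import boolp classical_sets.

(** The equivalence of (iii), (iv) and (v) is order theory. The preimage of
    [cset b] under [f] is [cset (fs b)], so both preimages occurring in (iii) are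
    known, and a left adjoint [h] as in (iii) can only send [cset a] to
    [cset (f a)]. Since [cset] turns binary joins into intersections, (iii) is the
    same identity as (iv). Granted (iv), every [y] above [f a] is the image of
    [a `|` fs y], whence (v), which contains (i).

    The content lies in passing from closedness to the projection formula of
    (iii). Its form for the basic image, [f_->(M & f_<-(C)) = f_->(M) & C] with
    [M] a member and [C] a closed domain, holds for every basic continuous map of
    b0-spaces ([bimage_projection]); when [f] is basic closed, [f_->] restricts
    to the map [h] of (iii). For the formula, [f_<-(C)] is complemented, so [M] is
    the join of its parts in [f_<-(C)] and in the complement of [f_<-(C)].
    The basic image preserves this join and maps the second part into the
    complement of [C]; intersecting with [C] leaves only the image of the first.

    Preservation of joins comes from the right adjoint of the basic image
    ([bpreimage_adjoint]), obtained as follows. Write [-D] for the complement of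
    [D] and [g] for the preimage on closed domains. A finite join of sets
    [C v -D] has a complement, and [f] maps the complement of the join of the
    [g C v -g D] into the complement of the join of the [C v -D]. As [f] reflects
    the bottom, a member that is mapped into the second join lies in the first
    ([image_sub_basic_join]); the converse is part of basic continuity. Since
    members are intersections of such joins, the right adjoint is computed by
    replacing [C v -D] with [g C v -g D].

    Finally, a continuous map of Heyting semilattices is basic continuous
    ([continuous_basic_continuous]): because [fs] preserves meets,
    [f (fs b ~> x) = b ~> f x], so [f] maps [oset (fs b)] into [oset b], and joins
    of ideals consist of finite meets, which [f] preserves. *)

Set Implicit Arguments.
Unset Strict Implicit.
Unset Printing Implicit Defensive.

Import Order.TTheory.
Local Open Scope classical_set_scope.

(** * Complements in distributive closure systems *)

Section ClosureSystems.
Variables (X : Type) (Bd : set (set X)).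
Hypotheses (clBd : closure_system Bd) (dBd : cs_distributive Bd).
Implicit Types (A B C K L M N : set X).

Lemma closure_smallest A : Bd (smallest Bd A).
Proof. by apply: clBd.2 => M []. Qed.

Lemma closure_setI A B : Bd A -> Bd B -> Bd (A `&` B).
Proof.
move=> bA bB; have : Bd (\bigcap_(S in [set A; B]) S).
  by apply: clBd.2 => _ [] ->.
by rewrite bigcap_setU !bigcap_set1.
Qed.

Lemma csbot_sub M : Bd M -> csbot Bd `<=` M.
Proof. by move=> bM; apply: smallest_sub. Qed.

Lemma csjoin_subl A B : A `<=` csjoin Bd A B.
Proof. by move=> x Ax; apply: sub_gen_smallest; left. Qed.

Lemma csjoin_subr A B : B `<=` csjoin Bd A B.
Proof. by move=> x Bx; apply: sub_gen_smallest; right. Qed.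

Lemma csjoin_sub A B M : Bd M -> A `<=` M -> B `<=` M -> csjoin Bd A B `<=` M.
Proof. by move=> bM AM BM; apply: smallest_sub => // x []; [exact: AM|exact: BM]. Qed.

Lemma csjoins_ord0 (M : 'I_0 -> set X) : csjoins Bd M = csbot Bd.
Proof. by congr smallest; apply/seteqP; split=> // x [[]]. Qed.

Lemma csjoins_recl n (M : 'I_n.+1 -> set X) : csjoins Bd M =
  csjoin Bd (M ord0) (csjoins Bd (fun i => M (lift ord0 i))).
Proof.
apply/seteqP; split.
  apply: smallest_sub; first exact: closure_smallest.
  move=> x [i _]; case: (unliftP ord0 i) => [j ->|->] Mx.
    by apply: csjoin_subr; apply: sub_gen_smallest; exists j.
  exact: csjoin_subl.
apply: csjoin_sub; first exact: closure_smallest.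
  by move=> x Mx; apply: sub_gen_smallest; exists ord0.
apply: smallest_sub; first exact: closure_smallest.
by move=> x [i _ Mx]; apply: sub_gen_smallest; exists (lift ord0 i).
Qed.

Lemma is_complement_sym C N : Bd C -> is_complement Bd C N -> is_complement Bd N C.
Proof. by move=> bC [_ I J]; split; rewrite // ?[N `&` C]setIC // /csjoin setUC. Qed.

Lemma csneg_complement C :
  (exists N, is_complement Bd C N) -> is_complement Bd C (csneg Bd C).
Proof. by move=> h; apply: (xgetPex set0 h). Qed.

Lemma csbot_complement : is_complement Bd (csbot Bd) setT.
Proof.
split; [exact: clBd.1|by rewrite setIT|].
by apply/seteqP; split=> // x _; exact: csjoin_subr.
Qed.

Lemma csjoin_split K K' M : Bd K -> is_complement Bd K K' -> Bd M ->
  M = csjoin Bd (M `&` K) (M `&` K').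
Proof. by move=> bK [bK' _ KK'] bM; rewrite -dBd // KK' setIT. Qed.

Lemma sub_complement K K' M : Bd K -> is_complement Bd K K' -> Bd M ->
  M `&` K' `<=` csbot Bd -> M `<=` K.
Proof.
move=> bK cK bM MK'; rewrite (csjoin_split bK cK bM).
apply: (csjoin_sub bK); first exact: subIsetr.
exact: subset_trans MK' (csbot_sub bK).
Qed.

(** De Morgan's law for a binary join. That the pair covers the space is seen by
    splitting [K'] along [L] and [L'], which puts it below the join [Z]. *)
Lemma csjoin_complement K K' L L' : Bd K -> Bd L ->
  is_complement Bd K K' -> is_complement Bd L L' ->
  is_complement Bd (csjoin Bd K L) (K' `&` L').
Proof.
move=> bK bL cK cL; have [bK' KK' jK] := cK; have [bL' LL' jL] := cL.
have bI := closure_setI bK' bL'.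
split=> //.
  apply/seteqP; split; last first.
    by apply: csbot_sub; apply: closure_setI => //; exact: closure_smallest.
  rewrite setIC dBd //; apply: csjoin_sub; first exact: closure_smallest.
    by rewrite -KK' => x [[]].
  by rewrite -LL' => x [[]].
set Z := csjoin _ _ _; have bZ : Bd Z by exact: closure_smallest.
have KLZ : csjoin Bd K L `<=` Z by exact: csjoin_subl.
apply/seteqP; split; first exact: subsetT.
rewrite -jK; apply: (csjoin_sub bZ).
  by move=> x Kx; apply: KLZ; exact: csjoin_subl.
rewrite (csjoin_split bL cL bK'); apply: (csjoin_sub bZ).
  by move=> x [_ Lx]; apply: KLZ; exact: csjoin_subr.
exact: csjoin_subr.
Qed.

End ClosureSystems.

(** * Basic images and preimages between b0-spaces *)

Section BasicMaps.
Variables X Y : b0space.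
Implicit Types (f : X -> Y) (g : set Y -> set X).

Let clX := @bdom_closure_system X.
Let clY := @bdom_closure_system Y.
Let dX := @bdom_distributive X.
Let dY := @bdom_distributive Y.

Lemma adjoint_on_unique (P : set (set X)) (Q : set (set Y)) l g g' S :
  adjoint_on P Q l g -> adjoint_on P Q l g' -> Q S -> g S = g' S.
Proof.
move=> [Pg ag] [Pg' ag'] QS; apply/seteqP; split.
  by apply/(ag' _ _ (Pg _ QS) QS)/(ag _ _ (Pg _ QS) QS).
by apply/(ag _ _ (Pg' _ QS) QS)/(ag' _ _ (Pg' _ QS) QS).
Qed.

Lemma image_cpreimage_sub f g C : is_cpreimage f g -> cdom C -> f @` g C `<=` C.
Proof. by move=> [gC adj] cC; apply/adj => //; exact: gC. Qed.

Lemma bimage_sub f M S : bdom S -> (bimage f M `<=` S <-> f @` M `<=` S).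
Proof.
move=> bS; split; last exact: smallest_sub.
by apply: subset_trans; exact: sub_gen_smallest.
Qed.

(** The complements of the two joins are the intersections of the sets
    [g D & -g C] and [D & -C]. The adjunction for [g] says that [f] maps [g D]
    into [D], and the second hypothesis that it maps [-g C] into [-C]. *)
Lemma basic_join_complement f g n (C D : 'I_n -> set Y) :
  is_cpreimage f g ->
  (forall B, cdom B -> csneg (@bdom X) (g B) `<=` f @^-1` csneg (@bdom Y) B) ->
  (forall i, cdom (C i) /\ cdom (D i)) ->
  exists K' J', [/\
    is_complement (@bdom X) (csjoins (@bdom X)
      (fun i => csjoin (@bdom X) (g (C i)) (csneg (@bdom X) (g (D i))))) K',
    is_complement (@bdom Y) (csjoins (@bdom Y)
      (fun i => csjoin (@bdom Y) (C i) (csneg (@bdom Y) (D i)))) J'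
    & K' `<=` f @^-1` J'].
Proof.
move=> gP gN; elim: n C D => [|n IHn] C D cCD.
  exists setT, setT; rewrite !csjoins_ord0.
  by split=> //; exact: csbot_complement.
have [K' [J' [cK cJ KJ]]] :=
  IHn (fun i => C (lift ord0 i)) (fun i => D (lift ord0 i)) (fun i => cCD _).
have [cC cD] := cCD ord0; have gcC := gP.1 _ cC; have gcD := gP.1 _ cD.
have negP (Z : b0space) (B : set Z) :
    cdom B -> is_complement (@bdom Z) B (csneg (@bdom Z) B).
  by move=> cB; exact: csneg_complement (cdom_complemented cB).
have co (Z : b0space) (A B : set Z) : cdom A -> cdom B ->
    is_complement (@bdom Z) (csjoin (@bdom Z) A (csneg (@bdom Z) B))
      (csneg (@bdom Z) A `&` B).
  move=> cA cB; have [bN _ _] := negP _ _ cB.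
  apply: csjoin_complement; [exact: bdom_closure_system|exact: bdom_distributive| | | |].
  - exact: cdom_bdom.
  - exact: bN.
  - exact: negP.
  - by apply: is_complement_sym; [exact: cdom_bdom|exact: negP].
exists ((csneg (@bdom X) (g (C ord0)) `&` g (D ord0)) `&` K').
exists ((csneg (@bdom Y) (C ord0) `&` D ord0) `&` J').
split.
- rewrite csjoins_recl //.
  by apply: csjoin_complement; try exact: closure_smallest; last exact: cK;
    [exact: clX|exact: dX|exact: co].
- rewrite csjoins_recl //.
  by apply: csjoin_complement; try exact: closure_smallest; last exact: cJ;
    [exact: clY|exact: dY|exact: co].
- move=> x [[Nx Dx] K'x]; split; last exact: KJ.
  split; first exact: gN.
  by apply: (image_cpreimage_sub gP cD); exists x.
Qed.

(** When [f] maps [M] into the join in [Y], the part of [M] in the complement of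
    the join in [X] is mapped into the bottom, so it is itself the bottom. *)
Lemma image_sub_basic_join f g n (C D : 'I_n -> set Y) M :
  f @^-1` csbot (@bdom Y) = csbot (@bdom X) -> is_cpreimage f g ->
  (forall B, cdom B -> csneg (@bdom X) (g B) `<=` f @^-1` csneg (@bdom Y) B) ->
  (forall i, cdom (C i) /\ cdom (D i)) -> bdom M ->
  f @` M `<=` csjoins (@bdom Y)
    (fun i => csjoin (@bdom Y) (C i) (csneg (@bdom Y) (D i))) ->
  M `<=` csjoins (@bdom X)
    (fun i => csjoin (@bdom X) (g (C i)) (csneg (@bdom X) (g (D i)))).
Proof.
move=> f0 gP gN cCD bM fM.
have [K' [J' [cK [_ JJ' _] KJ]]] := basic_join_complement gP gN cCD.
apply: (sub_complement dX _ cK bM); first exact: closure_smallest.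
move=> x [Mx K'x]; rewrite -f0 /preimage /= -JJ'.
by split; [apply: fM; exists x|exact: KJ].
Qed.

Lemma bpreimage_adjoint f : basic_continuous f ->
  adjoint_on (@bdom X) (@bdom Y) (bimage f) (bpreimage f).
Proof.
move=> [f0 [g [gP gN gJ]]]; rewrite /bpreimage.
apply: (@xgetPex _ _ (adjoint_on (@bdom X) (@bdom Y) (bimage f))).
(* As [S] is the intersection of the joins of sets [C v -D] above it, its
   preimage must be the intersection of the corresponding joins in [X]. *)
exists (fun S => \bigcap_(K in [set K | exists n (C D : 'I_n -> set Y),
  [/\ forall i, cdom (C i) /\ cdom (D i),
      S `<=` csjoins (@bdom Y)
        (fun i => csjoin (@bdom Y) (C i) (csneg (@bdom Y) (D i)))
    & K = csjoins (@bdom X)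
        (fun i => csjoin (@bdom X) (g (C i)) (csneg (@bdom X) (g (D i))))]]) K).
split=> [S bS|M S bM bS].
  by apply: clX.2 => _ [n [C [D [_ _ ->]]]]; exact: closure_smallest.
rewrite bimage_sub //; split.
  move=> fM x Mx _ [n [C [D [cCD SJ ->]]]].
  by apply: (image_sub_basic_join f0 gP gN cCD bM) => //; exact: subset_trans fM SJ.
move=> Mr _ [x /Mr rx <-].
have [F FJ SE] := bdom_generated bS; rewrite SE => J FJ'.
have [n [C [D [cCD JE]]]] := FJ _ FJ'.
rewrite JE; apply: (gJ _ _ _ cCD); apply: rx; exists n, C, D; split=> //.
by rewrite -JE SE => y; apply.
Qed.

Lemma cpreimageP f g : is_cpreimage f g -> is_cpreimage f (cpreimage f).
Proof. by move=> gP; apply: (@xgetPex _ _ [set g | is_cpreimage f g]); exists g. Qed.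

Lemma bimage_csjoin f M N : basic_continuous f -> bdom M -> bdom N ->
  bimage f (csjoin (@bdom X) M N)
    `<=` csjoin (@bdom Y) (bimage f M) (bimage f N).
Proof.
move=> /bpreimage_adjoint[rb adj] bM bN.
have bJ := closure_smallest clY (bimage f M `|` bimage f N).
apply/adj => //; first exact: closure_smallest.
apply: csjoin_sub; first exact: rb.
  by apply/adj => //; exact: csjoin_subl.
by apply/adj => //; exact: csjoin_subr.
Qed.

(** The projection formula. The part of [M] in the complement of the preimage of
    [C] is mapped into the complement of [C], so it contributes nothing to the
    image inside [C]. *)
Lemma bimage_projection f M C : basic_continuous f -> bdom M -> cdom C ->
  bimage f (M `&` cpreimage f C) = bimage f M `&` C.
Proof.
move=> fc bM cC; have [_ [g' [g'P g'N _]]] := fc.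
have gP := cpreimageP g'P; have gN := g'N _ cC.
rewrite (adjoint_on_unique g'P gP cC) in gN.
move: (cpreimage f) gP gN => g gP gN.
have bC := cdom_bdom cC; have bgC := cdom_bdom (gP.1 _ cC).
have cN := csneg_complement (cdom_complemented cC).
have cgN := csneg_complement (cdom_complemented (gP.1 _ cC)).
have [bN CN _] := cN; have [bgN _ _] := cgN.
apply/seteqP; split.
  apply/bimage_sub; first by apply: closure_setI => //; exact: closure_smallest.
  move=> _ [x [Mx gCx] <-]; split.
    by apply: sub_gen_smallest; exists x.
  by apply: (image_cpreimage_sub gP cC); exists x.
have bP : bdom (bimage f (M `&` g C)) by exact: closure_smallest.
have bQ : bdom (bimage f (M `&` csneg (@bdom X) (g C))) by exact: closure_smallest.
rewrite [in X in X `<=` _](csjoin_split dX bgC cgN bM).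
apply: (@subset_trans _ (C `&` csjoin (@bdom Y) (bimage f (M `&` g C))
    (bimage f (M `&` csneg (@bdom X) (g C))))).
  rewrite setIC; apply: setIS.
  by apply: bimage_csjoin => //; exact: closure_setI.
rewrite dY //; apply: (csjoin_sub bP); first exact: subIsetr.
apply: subset_trans (csbot_sub bP); rewrite -CN; apply: setIS.
by apply/bimage_sub => // _ [x [_ Nx] <-]; exact: gN.
Qed.

End BasicMaps.

Local Open Scope order_scope.

(** * Continuous maps of Heyting semilattices *)

Lemma cset_inj (d : Order.disp_t) (H : heytingSemilatticeType d) :
  injective (@cset d H).
Proof.
move=> a b ab; apply/le_anti/andP; split.
  by have : cset b b := lexx b; rewrite -ab.
by have : cset a a := lexx a; rewrite ab.
Qed.

Lemma cset_sub (d : Order.disp_t) (H : heytingSemilatticeType d) (a b : H) :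
  (cset a `<=` cset b)%classic <-> b <= a.
Proof. by split=> [/(_ a (lexx a))|ba x] //; exact: le_trans. Qed.

Section Continuous.
Variables (d1 d2 : Order.disp_t).
Variables (H1 : heytingSemilatticeType d1) (H2 : heytingSemilatticeType d2).
Variables (f : H1 -> H2) (fs : H2 -> H1).
Hypotheses (fsf : left_adjoint fs f).

Let X1 := heyting_b0space H1.
Let X2 := heyting_b0space H2.

Lemma left_adjoint_meet x y : f (x `&` y) = f x `&` f y.
Proof.
have E b : (b <= f (x `&` y)) = (b <= f x `&` f y) by rewrite -fsf !lexI !fsf.
by apply/le_anti; rewrite E lexx -E lexx.
Qed.

Lemma left_adjoint_top : f \top = \top.
Proof. by apply/eqP; rewrite -le1x -fsf lex1. Qed.

Lemma preimage_cset b : f @^-1` cset b = cset (fs b).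
Proof. by apply/seteqP; split=> x; rewrite /cset /= fsf. Qed.

Lemma preimage_cpreimage : is_cpreimage (f : X1 -> X2) (preimage f).
Proof.
split=> [_ [b _ <-]|M S _ _]; last exact: image_subP.
by exists (fs b) => //; rewrite preimage_cset.
Qed.

Lemma cpreimage_cset b : cpreimage (f : X1 -> X2) (cset b) = cset (fs b).
Proof.
rewrite -preimage_cset.
apply: (adjoint_on_unique (cpreimageP preimage_cpreimage) preimage_cpreimage).
by exists b.
Qed.

(** The adjunction determines [h]: the closed domain [h (cset a)] lies in
    [cset b] exactly when [fs b <= a], that is, when [b <= f a]. *)
Lemma cdom_left_adjoint_cset h a :
  @cdom_left_adjoint X1 X2 h (cpreimage (f : X1 -> X2)) ->
  h (cset a) = cset (f a).
Proof.
move=> [hc [_ adj]]; have ca : csets (cset a) by exists a.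
have [e _ he] := hc _ ca; rewrite -he; congr cset.
have E b : b <= e <-> b <= f a.
  rewrite -cset_sub he -fsf -cset_sub -cpreimage_cset.
  by apply: adj => //; exists b.
by apply/le_anti/andP; split; apply/E.
Qed.

Hypothesis fsM : preserves_finite_meets fs.

Lemma continuous_imp b x : f (fs b ~> x) = b ~> f x.
Proof.
have E c : (c <= f (fs b ~> x)) = (c <= b ~> f x).
  by rewrite -fsf -!impP -fsM.2 fsf.
by apply/le_anti; rewrite E lexx -E lexx.
Qed.

Lemma continuous_oset b : oset (fs b) `<=` f @^-1` oset b.
Proof. by move=> _ [x _ <-]; exists (f x) => //; rewrite continuous_imp. Qed.

Lemma continuous_preimage_top : f @^-1` [set \top] = [set (\top : H1)].
Proof.
apply/seteqP; split=> x /= fx; last by rewrite fx left_adjoint_top.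
by apply/eqP; rewrite -le1x -fsM.1 fsf fx.
Qed.

(** The preimage of an ideal need not be an ideal, but [f] preserves the finite
    meets of which joins of ideals consist. *)
Lemma image_csjoin_ideal A B A' B' : ideal A -> ideal B -> ideal A' -> ideal B' ->
  A `<=` f @^-1` A' -> B `<=` f @^-1` B' ->
  csjoin (@ideal _ H1) A B `<=` f @^-1` csjoin (@ideal _ H2) A' B'.
Proof.
move=> iA iB iA' iB' AA BB x; rewrite /preimage /= !csjoin_ideal //.
move=> [u [v [/AA Au /BB Bv ->]]].
by exists (f u), (f v); rewrite left_adjoint_meet.
Qed.

Lemma image_csjoins_ideal n (a b : 'I_n -> H2) :
  csjoins (@ideal _ H1)
    (fun i => csjoin (@ideal _ H1) (cset (fs (a i))) (oset (fs (b i))))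
  `<=` f @^-1` csjoins (@ideal _ H2)
    (fun i => csjoin (@ideal _ H2) (cset (a i)) (oset (b i))).
Proof.
elim: n a b => [|n IHn] a b.
  by rewrite !csjoins0 continuous_preimage_top.
rewrite !csjoinsS; apply: image_csjoin_ideal; try exact: ideal_smallest.
  apply: image_csjoin_ideal; do ?[exact: ideal_cset|exact: ideal_oset].
    by rewrite preimage_cset.
  exact: continuous_oset.
exact: IHn.
Qed.

Lemma csjoins_bd_ideal (d : Order.disp_t) (H : heytingSemilatticeType d) n
    (a b : 'I_n -> H) :
  csjoins (@bd _ H) (fun i => csjoin (@bd _ H) (cset (a i)) (oset (b i))) =
  csjoins (@ideal _ H) (fun i => csjoin (@ideal _ H) (cset (a i)) (oset (b i))).
Proof.
under eq_fun do rewrite csjoin_bd_co.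
by apply: smallest_bd_ideal; apply: bd_gen_bd; exists n, a, b.
Qed.

Lemma continuous_csneg C : csets C ->
  csneg (@bd _ H1) (f @^-1` C) `<=` f @^-1` csneg (@bd _ H2) C.
Proof.
by move=> [b _ <-]; rewrite preimage_cset !csneg_cset; exact: continuous_oset.
Qed.

Lemma continuous_basic_continuous : basic_continuous (f : X1 -> X2).
Proof.
split; first by rewrite /= !csbot_bd; exact: continuous_preimage_top.
exists (preimage f); split.
- exact: preimage_cpreimage.
- exact: continuous_csneg.
move=> n C D cCD /=.
have [a aC] : exists a, C = fun i => cset (a i).
  have /choice[a aC] : forall i, exists a, cset a = C i.
    by move=> i; have [[a _ aC] _] := cCD i; exists a.
  by exists a; apply/funext => i; rewrite aC.
have [b bD] : exists b, D = fun i => cset (b i).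
  have /choice[b bD] : forall i, exists b, cset b = D i.
    by move=> i; have [_ [b _ bD]] := cCD i; exists b.
  by exists b; apply/funext => i; rewrite bD.
rewrite {}aC {}bD.
have -> : (fun i => csjoin (@bd _ H1) (f @^-1` cset (a i))
      (csneg (@bd _ H1) (f @^-1` cset (b i)))) =
    (fun i => csjoin (@bd _ H1) (cset (fs (a i))) (oset (fs (b i)))).
  by apply/funext => i; rewrite !preimage_cset csneg_cset.
have -> : (fun i => csjoin (@bd _ H2) (cset (a i)) (csneg (@bd _ H2) (cset (b i))))
    = (fun i => csjoin (@bd _ H2) (cset (a i)) (oset (b i))).
  by apply/funext => i; rewrite csneg_cset.
by rewrite !csjoins_bd_ideal; exact: image_csjoins_ideal.
Qed.

Lemma bpreimage_cset b : bpreimage (f : X1 -> X2) (cset b) = cset (fs b).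
Proof.
have [rb adj] := bpreimage_adjoint continuous_basic_continuous.
have E M : bd M ->
    (M `<=` bpreimage (f : X1 -> X2) (cset b) <-> M `<=` cset (fs b))%classic.
  move=> bM; rewrite -preimage_cset; have bb := bd_cset b.
  have := adj M _ bM bb; have := bimage_sub (f : X1 -> X2) M bb.
  have : (f @` M `<=` cset b <-> M `<=` f @^-1` cset b)%classic := image_subP.
  tauto.
apply/seteqP; split; first by apply/E => //; exact: rb (bd_cset b).
by apply/E => //; exact: bd_cset.
Qed.

End Continuous.

(** * Closed maps of Heyting lattices *)

Lemma cset_join (d : Order.disp_t) (H : heytingLatticeType d) (a b : H) :
  (cset a `&` cset b)%classic = cset (a `|` b).
Proof.
by apply/seteqP; split=> x; rewrite /cset /= leUx => /andP.
Qed.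

Theorem theorem11p1 (d1 d2 : Order.disp_t)
    (H1 : heytingLatticeType d1) (H2 : heytingLatticeType d2)
    (f : H1 -> H2) (fs : H2 -> H1)
    (hf : heyting_continuous f) (hfs : left_adjoint fs f) :
  let X1 := heyting_b0space H1 in
  let X2 := heyting_b0space H2 in
  let f0 : X1 -> X2 := f in
  [<-> closed_map f;
       basic_closed f0;
       exists2 h : set X1 -> set X2,
         cdom_left_adjoint h (cpreimage f0) &
         forall (a : H1) (b : H2),
           h (cset a `&` bpreimage f0 (cset b))%classic =
           (h (cset a) `&` cset b)%classic;
       forall (a : H1) (b : H2), f (a `|` fs b) = f a `|` b;
       forall a : H1, f @` cset a = cset (f a)].
Proof.
move=> X1 X2 f0.
have fsM : preserves_finite_meets fs.
  have [gs gsf gsM] := hf; suff -> : fs = gs by [].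
  by apply/funext => b; apply/le_anti; rewrite hfs -gsf lexx gsf -hfs lexx.
have fc : basic_continuous f0 := continuous_basic_continuous hfs fsM.
have fP : is_cpreimage f0 (preimage f) := preimage_cpreimage hfs.
tfae.
- move=> fcl; split=> // _ [a _ <-]; have [b _ fab] := fcl a.
  suff -> : bimage f0 (cset a) = cset b by exists b.
  rewrite /bimage -fab; apply/seteqP; split; last exact: sub_gen_smallest.
  by apply: smallest_sub => //; exact: bd_cset.
- move=> [_ fcl]; exists (bimage f0); last first.
    move=> a b; rewrite (bpreimage_cset hfs fsM) -(cpreimage_cset hfs).
    by apply: bimage_projection => //; [exact: bd_cset|exists b].
  split=> //; have [gc adj] := cpreimageP fP; split=> // M S cM cS.
  by rewrite bimage_sub; [exact: adj|exact: cdom_bdom].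
- move=> [h hadj hI] a b; apply: cset_inj; rewrite -cset_join.
  by rewrite -!(cdom_left_adjoint_cset hfs _ hadj) -hI (bpreimage_cset hfs fsM) cset_join.
- move=> fU a; apply/seteqP; split=> [_ [x ax <-]|y ay].
    by rewrite /cset /= -hfs (le_trans _ ax) // hfs.
  exists (a `|` fs y); first exact: leUl.
  by rewrite fU; apply/join_idPr.
- by move=> fca a; rewrite fca; exists (f a).
Qed.
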